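(* Let $M\ge 2$ be an integer, $\rho>0$, $0<a_2\le\tfrac12$, $a_1=1-a_2$. Let $|h_1|^2\le\cdots\le|h_M|^2$ be the order statistics of $M$ i.i.d. exponential random variables with mean $1$, and put $x=\rho|h_1|^2$, $y=\rho|h_M|^2$ (i.e. user $m=1$ is paired with user $n=M$). Let $R_1^N=\log_2\left(1+\frac{a_1x}{1+a_2x}\right)$, $R_2^N=\log_2(1+a_2y)$, $R_1^T=\frac12\log_2(1+x)$, $R_2^T=\frac12\log_2(1+y)$, and $P(\varepsilon_2)=P\left(R_1^N>R_1^T,\ R_2^N>R_2^T\right)$. Then $$P(\varepsilon_2)=1-(1-d)^M-d^M,\qquad d=e^{-w_2/\rho},\quad w_2=\frac{1-2a_2}{a_2^2}.$$ Moreover, the value of $d$ maximizing $P(\varepsilon_2)$ (as $a_2$ ranges over $(0,\tfrac12]$) is $d=\tfrac12$, which corresponds to $a_2=\frac{-1+\sqrt{1+\rho\ln 2}}{\rho\ln 2}<\frac12$, and for this choice $P(\varepsilon_2)=1-\frac{1}{2^{M-1}}$.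
   Context: The setting is a downlink with $M$ users with Rayleigh fading channel gains ordered as $|h_1|^2\le\cdots\le|h_M|^2$; $\rho$ is the transmit signal-to-noise ratio. $(R_1^N,R_2^N)$ are the rates achieved by non-orthogonal multiple access (NOMA) with fixed power allocation coefficients $a_1+a_2=1$, $a_1\ge a_2$, and $(R_1^T,R_2^T)$ are the rates of time-division multiple access (TDMA) with equal time slots. $\ln$ is the natural logarithm. *)

(* Defs.v *)
From HB Require Import structures.
From mathcomp Require Import all_boot all_order all_algebra.
From mathcomp Require Import all_classical all_reals all_analysis.

Set Implicit Arguments.
Unset Strict Implicit.
Unset Printing Implicit Defensive.

Import Order.TTheory GRing.Theory Num.Theory.
Import numFieldNormedType.Exports.

Local Open Scope classical_set_scope.
Local Open Scope ring_scope.

(* Mutual independence: the product rule holds for every subfamily [J], not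
   only for pairs. *)
Definition mutually_independent {R : realType} {d : measure_display}
    {T : measurableType d} (P : probability T R) (I : finType)
    (X : I -> {RV P >-> R}) : Prop :=
  forall (J : {set I}) (A : I -> set R),
    (forall i, i \in J -> measurable (A i)) ->
    P (\bigcap_(i in [set` J]) X i @^-1` A i) =
    (\prod_(i in J) P (X i @^-1` A i))%E.

(* Equality of laws is only required on Borel sets: [exponential_prob] is an
   integral, whose value on a non-measurable set carries no meaning. *)
Definition has_exponential_law {R : realType} {d : measure_display}
    {T : measurableType d} (P : probability T R) (rate : R)
    (X : {RV P >-> R}) : Prop :=
  forall A : set R, measurable A ->
    distribution P X A = exponential_prob rate A.

(* Indices start at 0: [order_stat X 0] is the minimum and, for n >= 1,
   [order_stat X n.-1] is the maximum of the sample. *)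
Definition order_stat {R : realType} {T : Type} (n : nat)
    (X : 'I_n -> T -> R) (k : nat) (t : T) : R :=
  nth 0 (sort <=%R [seq X i t | i <- enum 'I_n]) k.

Definition log2 {R : realType} (x : R) : R := ln x / ln 2.

(* [x] and [y] are the received SNRs (rho times channel gain) of the weak and
   of the strong user of the pair. *)
Definition noma_rate1 {R : realType} (a1 a2 x : R) : R :=
  log2 (1 + a1 * x / (1 + a2 * x)).

Definition noma_rate2 {R : realType} (a2 y : R) : R := log2 (1 + a2 * y).

Definition tdma_rate {R : realType} (z : R) : R := 2^-1 * log2 (1 + z).

(* The event that both users have a larger rate with NOMA than with TDMA. *)
Definition eps2 {R : realType} {T : Type} (a1 a2 : R) (x y : T -> R) : set T :=
  [set t | noma_rate1 a1 a2 (x t) > tdma_rate (x t) /\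
           noma_rate2 a2 (y t) > tdma_rate (y t)].

Definition w2 {R : realType} (a2 : R) : R := (1 - 2 * a2) / a2 ^+ 2.

(* Main.v *)
(** For z > 0 one has (1 + a z)^2 - (1 + z) = a^2 z (z - w2 a), so NOMA beats
    TDMA for the weak user iff x < w2 a and for the strong user iff y > w2 a.
    Almost surely all gains are positive, and then the event is the complement
    of "all gains >= w2 a / rho" or "all gains <= w2 a / rho"; these two have
    probabilities d^M and (1 - d)^M by independence, and meet in a null set.
    For M >= 2, d^M + (1 - d)^M is minimal on [0, 1] exactly at d = 1/2, and
    d = 1/2 is the quadratic equation (K a + 1)^2 = 1 + K with K = rho ln 2. *)
Require Import Defs.
From mathcomp Require Import all_boot all_order all_algebra.
From mathcomp Require Import all_classical all_reals all_analysis.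
From mathcomp Require Import measurable_realfun.
From mathcomp Require Import ring lra zify.

Set Implicit Arguments.
Unset Strict Implicit.
Unset Printing Implicit Defensive.

Import Order.TTheory GRing.Theory Num.Theory.
Import numFieldNormedType.Exports.
Local Open Scope classical_set_scope.
Local Open Scope ring_scope.

(** * Power sums of [p] and [1 - p] *)

(** Induction from [n = 2], where the gap between the two sides is [2 * (p - 1/2)^2]. Each further
    step exactly halves the left side, while the right side keeps at least half of its value because
    the weights [1 - p] and [p] are ordered like their powers. *)
Lemma lt_sum_expr_half {R : realFieldType} (n : nat) (p : R) :
  (2 <= n)%N -> 0 <= p <= 1 -> p != 2^-1 ->
  2 * 2^-1 ^+ n < (1 - p) ^+ n + p ^+ n.
Proof.
move=> + /andP[p0 p1] pneq; elim: n => // n IH; rewrite ltnS leq_eqVlt.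
move=> /predU1P[<-|n1].
  have : 0 < (p - 2^-1) ^+ 2 by rewrite exprn_even_gt0//= subr_eq0.
  by rewrite !expr2; lra.
have {IH n1} := IH n1; set q := 1 - p => IH.
(* Chebyshev's sum inequality for two terms *)
have cheb : 0 <= (q - p) * (q ^+ n - p ^+ n).
  have q0 : 0 <= q by rewrite subr_ge0.
  have [qp|/ltW qp] := leP p q.
    by rewrite mulr_ge0// subr_ge0// lerXn2r// nnegrE.
  by rewrite mulr_le0// subr_le0// lerXn2r// nnegrE.
rewrite !exprS.
have -> : q * q ^+ n + p * p ^+ n =
    2^-1 * (q ^+ n + p ^+ n) + 2^-1 * ((q - p) * (q ^+ n - p ^+ n)).
  by rewrite /q; field.
by move: cheb IH; set s := 2^-1 ^+ n; lra.
Qed.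

(** * Rate comparisons as polynomial inequalities *)

(** The factor 1/2 of the equal time slots turns into the square of [u]. *)
Lemma tdma_rate_lt_log2 {R : realType} (z u : R) : 0 < 1 + z -> 0 < u ->
  (tdma_rate z < log2 u) = (1 + z < u ^+ 2).
Proof.
move=> z0 u0; rewrite /tdma_rate /log2 mulrA ltr_pM2r; last first.
  by rewrite invr_gt0 ln_gt0// ltr1n.
rewrite -[RHS]ltr_ln ?posrE ?exprn_gt0// lnXn//.
by rewrite -[ln u *+ 2]mulr_natl ltr_pdivrMl.
Qed.

Lemma sqr_sub_w2 {R : realType} (a z : R) : a != 0 ->
  (1 + a * z) ^+ 2 - (1 + z) = a ^+ 2 * z * (z - w2 a).
Proof. by move=> a0; rewrite /w2; field. Qed.

(** As the power coefficients sum to 1, the argument of the logarithm collapses to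
    [(1 + x) / (1 + a * x)]. The comparison becomes [(1 + a * x)^2 < 1 + x], the reverse of the one
    for the strong user. *)
Lemma tdma_lt_noma_rate1 {R : realType} (a x : R) : 0 < a -> 0 < x ->
  (tdma_rate x < noma_rate1 (1 - a) a x) = (x < w2 a).
Proof.
move=> a0 x0; have ax0 : 0 < 1 + a * x by rewrite addr_gt0// mulr_gt0.
have x10 : 0 < 1 + x by rewrite addr_gt0.
have -> : noma_rate1 (1 - a) a x = log2 ((1 + x) / (1 + a * x)).
  by rewrite /noma_rate1; congr log2; field; rewrite gt_eqF.
rewrite tdma_rate_lt_log2// ?divr_gt0// expr_div_n ltr_pdivlMr ?exprn_gt0//.
rewrite expr2 ltr_pM2l// -subr_lt0 sqr_sub_w2 ?gt_eqF//.
by rewrite pmulr_rlt0 ?subr_lt0// mulr_gt0// exprn_gt0.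
Qed.

Lemma tdma_lt_noma_rate2 {R : realType} (a y : R) : 0 < a -> 0 < y ->
  (tdma_rate y < noma_rate2 a y) = (w2 a < y).
Proof.
move=> a0 y0; rewrite tdma_rate_lt_log2 ?addr_gt0 ?mulr_gt0//.
rewrite -subr_gt0 sqr_sub_w2 ?gt_eqF//.
by rewrite pmulr_rgt0 ?subr_gt0// mulr_gt0// exprn_gt0.
Qed.

(** * Measurability of the rates and of the event *)

Lemma measurable_inv {R : realType} : measurable_fun [set: R] (@GRing.inv R).
Proof.
(* with 0^-1 = 0 the formula also holds at 0, so no case split is needed *)
have -> : @GRing.inv R = (fun z => z * expR (- ln (z ^+ 2))).
  apply/funext => z; have [->|z0] := eqVneq z 0; first by rewrite invr0 mul0r.
  by rewrite expRN lnK ?posrE ?exprn_even_gt0//=; field.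
apply: measurable_funM => //; apply: measurableT_comp => //.
by apply: measurable_funN; exact: measurableT_comp.
Qed.

Lemma measurable_log2 {R : realType} : measurable_fun [set: R] (@log2 R).
Proof. by apply: measurable_funM => //; exact: measurable_ln. Qed.

Lemma measurable_tdma_rate {R : realType} :
  measurable_fun [set: R] (@tdma_rate R).
Proof.
apply: measurable_funM => //; apply: (measurableT_comp measurable_log2).
exact: measurable_funD.
Qed.

Lemma measurable_noma_rate1 {R : realType} (a1 a2 : R) :
  measurable_fun [set: R] (noma_rate1 a1 a2).
Proof.
apply: (measurableT_comp measurable_log2); apply: measurable_funD => //.
apply: measurable_funM; first exact: measurable_funM.
apply: (measurableT_comp measurable_inv).
by apply: measurable_funD => //; exact: measurable_funM.
Qed.

Lemma measurable_noma_rate2 {R : realType} (a2 : R) :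
  measurable_fun [set: R] (noma_rate2 a2).
Proof.
by apply: (measurableT_comp measurable_log2); exact: measurable_funD.
Qed.

Lemma measurable_eps2 {R : realType} {d : measure_display}
    {T : measurableType d} (a1 a2 : R) (x y : T -> R) :
  measurable_fun [set: T] x -> measurable_fun [set: T] y ->
  measurable (eps2 a1 a2 x y).
Proof.
have mlt (f h : R -> R) (z : T -> R) : measurable_fun [set: R] f ->
    measurable_fun [set: R] h -> measurable_fun [set: T] z ->
    measurable [set t | f (z t) < h (z t)].
  move=> mf mh mz; rewrite -[X in measurable X]setTI.
  have := measurable_fun_ltr (measurableT_comp mf mz) (measurableT_comp mh mz).
  by move=> /(_ measurableT [set true] I); exact.
move=> mx my; apply: measurableI; apply: mlt => //.
- exact: measurable_tdma_rate.
- exact: measurable_noma_rate1.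
- exact: measurable_tdma_rate.
- exact: measurable_noma_rate2.
Qed.

(** * Minimum and maximum of the sample *)

(** The bound [k < n] keeps [nth] away from its default value 0, so the result is an entry of the
    sorted sample. *)
Lemma order_stat_attained {R : realType} {T : Type} (n k : nat)
    (X : 'I_n -> T -> R) (t : T) : (k < n)%N ->
  exists i, order_stat X k t = X i t.
Proof.
move=> kn; have : order_stat X k t \in sort <=%R [seq X i t | i <- enum 'I_n].
  by rewrite mem_nth// size_sort size_map size_enum_ord.
by rewrite mem_sort => /mapP[i _ ->]; exists i.
Qed.

Lemma order_stat_bounds {R : realType} {T : Type} (n : nat)
    (X : 'I_n -> T -> R) (t : T) (i : 'I_n) :
  order_stat X 0 t <= X i t <= order_stat X n.-1 t.
Proof.
have n0 : (0 < n)%N by case: n X i => [|//] _ [].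
set s := sort <=%R [seq X j t | j <- enum 'I_n].
have ss : size s = n by rewrite size_sort size_map size_enum_ord.
have : X i t \in s by rewrite mem_sort map_f// mem_enum.
move=> /(nthP 0)[j]; rewrite ss => jn <-.
have mono := le_sorted_leq_nth 0 (sort_le_sorted [seq X j t | j <- enum 'I_n]).
apply/andP; split; apply: mono; rewrite ?inE -?/s ?ss//; move: jn; lia.
Qed.

(** This reduces measurability of the minimum to a finite intersection. For [n = 0] it would fail:
    [nth] returns 0, while the empty intersection is the whole space. *)
Lemma order_stat_min_gt {R : realType} {T : Type} (n : nat)
    (X : 'I_n -> T -> R) (c : R) : (0 < n)%N ->
  [set t | c < order_stat X 0 t] = \bigcap_i [set t | c < X i t].
Proof.
move=> n0; apply/seteqP; split => t /=.
  by move=> ct i _ /=; apply: lt_le_trans ct _; case/andP: (order_stat_bounds X t i).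
by move=> h; have [i ->] := order_stat_attained X t n0; exact: h.
Qed.

Lemma order_stat_max_gt {R : realType} {T : Type} (n : nat)
    (X : 'I_n -> T -> R) (c : R) : (0 < n)%N ->
  [set t | c < order_stat X n.-1 t] = \bigcup_i [set t | c < X i t].
Proof.
move=> n0; apply/seteqP; split => t /=.
  have [|i ->] := order_stat_attained (k := n.-1) X t; first by rewrite ltn_predL.
  by move=> ct; exists i.
by move=> [i _ /= ct]; apply: lt_le_trans ct _; case/andP: (order_stat_bounds X t i).
Qed.

(** The open right rays generate the Borel sets of the line. *)
Lemma measurable_fun_superlevel {R : realType} {d : measure_display}
    {T : measurableType d} (f : T -> R) :
  (forall c, measurable [set t | c < f t]) -> measurable_fun [set: T] f.
Proof.
move=> mf; apply: (measurability _ (RGenOInfty.measurableE R)) => //.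
by move=> _ [_ [c ->] <-]; rewrite setTI preimage_itvoy; exact: mf.
Qed.

Lemma measurable_superlevel {R : realType} {d : measure_display}
    {T : measurableType d} (f : T -> R) (c : R) :
  measurable_fun [set: T] f -> measurable [set t | c < f t].
Proof.
by move=> mf; rewrite -preimage_itvoy -[X in measurable X]setTI; exact: mf.
Qed.

Lemma measurable_order_stat_min {R : realType} {d : measure_display}
    {T : measurableType d} (n : nat) (X : 'I_n -> T -> R) : (0 < n)%N ->
  (forall i, measurable_fun [set: T] (X i)) ->
  measurable_fun [set: T] (order_stat X 0).
Proof.
move=> n0 mX; apply: measurable_fun_superlevel => c; rewrite order_stat_min_gt//.
apply: fin_bigcap_measurable => [|i _]; first exact: finite_finset.
exact: measurable_superlevel.
Qed.

Lemma measurable_order_stat_max {R : realType} {d : measure_display}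
    {T : measurableType d} (n : nat) (X : 'I_n -> T -> R) : (0 < n)%N ->
  (forall i, measurable_fun [set: T] (X i)) ->
  measurable_fun [set: T] (order_stat X n.-1).
Proof.
move=> n0 mX; apply: measurable_fun_superlevel => c; rewrite order_stat_max_gt//.
apply: fin_bigcup_measurable => [|i _]; first exact: finite_finset.
exact: measurable_superlevel.
Qed.

(** * Exponential probabilities of points and rays *)

Lemma exponential_prob_set1 {R : realType} (rate c : R) :
  exponential_prob rate [set c] = 0%E.
Proof. exact: integral_set1. Qed.

(** The density vanishes on the negative half-line, so only [[0, c]] contributes. *)
Lemma exponential_prob_le {R : realType} (rate c : R) : 0 <= rate -> 0 <= c ->
  exponential_prob rate `]-oo, c] = (1 - expR (- rate * c))%:E.
Proof.
move=> r0 c0.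
have -> : `]-oo, c]%classic = `]-oo, 0[%classic `|` `[0, c]%classic.
  apply/seteqP; split => x /=; rewrite !in_itv/=.
    by move=> xc; case: (ltP x 0) => x0; [left|right].
  by move=> [/ltW/le_trans|/andP[]//]; exact.
rewrite /exponential_prob ge0_integral_setU//=.
- rewrite integral0_eq ?add0e => [|x]; last first.
    by rewrite /= in_itv/= => x0; rewrite lt0_exponential_pdf.
  (* At [c = 0] the interval is a single point and both sides are 0. *)
  move: c0; rewrite le_eqVlt => /predU1P[<-|c0].
    by rewrite set_itv1 integral_set1 mulr0 expR0 subrr.
  exact: exponential_prob_itv0c.
- by apply/measurable_EFinP; apply: measurable_funTS; exact: measurable_exponential_pdf.
- by move=> x _; rewrite lee_fin exponential_pdf_ge0.
- apply/disj_setPLR => x /=; rewrite !in_itv/= => x0 /andP[].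
  by rewrite leNgt x0.
Qed.

Lemma exponential_law_eq0 {R : realType} {d : measure_display}
    {T : measurableType d} (P : probability T R) (rate : R) (X : {RV P >-> R})
    (c : R) :
  has_exponential_law rate X -> P (X @^-1` [set c]) = 0%E.
Proof. by move=> X_exp; rewrite -(exponential_prob_set1 rate c); exact: X_exp. Qed.

Lemma exponential_law_le {R : realType} {d : measure_display}
    {T : measurableType d} (P : probability T R) (rate : R) (X : {RV P >-> R})
    (c : R) :
  has_exponential_law rate X -> 0 <= rate -> 0 <= c ->
  P (X @^-1` `]-oo, c]) = (1 - expR (- rate * c))%:E.
Proof. by move=> X_exp r0 c0; rewrite -exponential_prob_le//; exact: X_exp. Qed.

Lemma exponential_law_gt {R : realType} {d : measure_display}
    {T : measurableType d} (P : probability T R) (rate : R) (X : {RV P >-> R})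
    (c : R) :
  has_exponential_law rate X -> 0 <= rate -> 0 <= c ->
  P (X @^-1` `]c, +oo[) = (expR (- rate * c))%:E.
Proof.
move=> X_exp r0 c0; have mle : measurable (X @^-1` `]-oo, c]) by exact: measurable_funPTI.
rewrite -setCitvl preimage_setC probability_setC//.
by rewrite (exponential_law_le X_exp)// -EFinB subKr.
Qed.

(** The law has no atoms, so closing the ray at [c] adds a null set. *)
Lemma exponential_law_ge {R : realType} {d : measure_display}
    {T : measurableType d} (P : probability T R) (rate : R) (X : {RV P >-> R})
    (c : R) :
  has_exponential_law rate X -> 0 <= rate -> 0 <= c ->
  P (X @^-1` `[c, +oo[) = (expR (- rate * c))%:E.
Proof.
move=> X_exp r0 c0; rewrite -(exponential_law_gt X_exp)//.
have -> : `[c, +oo[%classic = `]c, +oo[ `|` [set c] by rewrite setUC setU1itv.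
rewrite preimage_setU; apply: measureU0; last exact: exponential_law_eq0 X_exp.
  exact: measurable_funPTI.
exact: measurable_funPTI.
Qed.

(** * Probability of the event *)

(** The product rule is taken at the full index set. *)
Lemma independent_preim_const {R : realType} {d : measure_display}
    {T : measurableType d} (P : probability T R) (n : nat)
    (X : 'I_n -> {RV P >-> R}) (A : set R) (p : R) :
  mutually_independent X -> measurable A ->
  (forall i, P (X i @^-1` A) = p%:E) ->
  P (\bigcap_i X i @^-1` A) = (p ^+ n)%:E.
Proof.
move=> indep mA pA; have := indep [set: 'I_n]%SET (fun=> A) (fun _ _ => mA).
have -> : [set` [set: 'I_n]%SET] = [set: 'I_n].
  by apply/seteqP; split => i //= _; rewrite inE.
move=> ->; rewrite (eq_bigr (fun=> p%:E)) => [|i _]; last exact: pA.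
rewrite prodEFin; congr EFin.
by rewrite prodr_const cardsT card_ord.
Qed.

Lemma prob_eps2_minmax {R : realType} {disp : measure_display}
    {T : measurableType disp} (P : probability T R) (M : nat)
    (rho a : R) (g : 'I_M -> {RV P >-> R}) :
  (0 < M)%N -> 0 < rho -> 0 < a <= 2^-1 -> mutually_independent g ->
  (forall i, has_exponential_law 1 (g i)) ->
  P (eps2 (1 - a) a (fun t => rho * order_stat g 0 t)
                    (fun t => rho * order_stat g M.-1 t)) =
  (1 - (1 - expR (- w2 a / rho)) ^+ M - expR (- w2 a / rho) ^+ M)%:E.
Proof.
move=> M0 rho0 /andP[a0 a2] g_indep g_exp.
set E := eps2 _ _ _ _; set c := w2 a / rho; rewrite mulNr -/c; set p := expR (- c).
(* [c] is the threshold [w2 a] rescaled from received SNR to channel gain. Its sign comes from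
   [a <= 1/2], and the exponential formulas need it. *)
have c0 : 0 <= c.
  by rewrite divr_ge0 ?(ltW rho0)// divr_ge0 ?exprn_ge0 ?(ltW a0)//; lra.
have mg i A : measurable A -> measurable (g i @^-1` A).
  by move=> mA; exact: measurable_funPTI.
have mcap (A : set R) : measurable A -> measurable (\bigcap_i g i @^-1` A).
  by move=> mA; apply: fin_bigcap_measurable => [|i _]; [exact: finite_finset|exact: mg].
have mgfun i : measurable_fun [set: T] (g i) by [].
have mE : measurable E.
  apply: measurable_eps2; apply: measurable_funM => //.
  - exact: measurable_order_stat_min.
  - exact: measurable_order_stat_max.
(* Both rays are closed because the event asks for strict inequalities: its failure means that the
   minimum is at least [c] or the maximum at most [c]. *)
set A := \bigcap_i g i @^-1` `[c, +oo[; set B := \bigcap_i g i @^-1` `]-oo, c].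
(* off Z, x = 0 or a negative argument of [ln] would break the equivalence *)
set Z := \bigcap_i g i @^-1` `]0, +oo[.
have mA : measurable A by exact: mcap.
have mB : measurable B by exact: mcap.
have mZ : measurable Z by exact: mcap.
have PA : P A = (p ^+ M)%:E.
  apply: independent_preim_const => // i.
  by rewrite (exponential_law_ge (g_exp i))// mulN1r.
have PB : P B = ((1 - p) ^+ M)%:E.
  apply: independent_preim_const => // i.
  by rewrite (exponential_law_le (g_exp i))// mulN1r.
have PZC : P (~` Z) = 0%E.
  rewrite probability_setC// (independent_preim_const (p := 1) g_indep)//.
    by rewrite expr1n subee.
  by move=> i; rewrite (exponential_law_gt (g_exp i))// mulr0 expR0.
(* On the intersection every gain equals [c]; looking at one of them already gives a null set. *)
have PAB : P (A `&` B) = 0%E.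
  apply: (@subset_measure0 _ _ _ P _ (g (Ordinal M0) @^-1` [set c])) => //.
  - exact: measurableI.
  - move=> t [/(_ (Ordinal M0) I) At /(_ (Ordinal M0) I) Bt] /=.
    move: At Bt; rewrite /= in_itv/= andbT => cg; rewrite in_itv/= => gc.
    by apply/eqP; rewrite eq_le gc cg.
  - exact: exponential_law_eq0 c (g_exp _).
have EAB : E `|` ~` Z = ~` (A `|` B) `|` ~` Z.
  suff EAB t : Z t -> E t <-> ~ (A t \/ B t).
    apply/seteqP; split => t [Ht|]; try (by right);
      have [Zt|] := pselect (Z t); try (by right); left.
      by have /(EAB t Zt) := Ht.
    by apply/(EAB t Zt).
  move=> Zt; have gpos i : 0 < g i t.
    by have := Zt i I; rewrite /= in_itv/= andbT.
  (* Index [i] has the smallest gain and [j] the largest: on the event, [i] refutes [A] and [j]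
     refutes [B]. *)
  have [i gi] := order_stat_attained g t M0.
  have [j gj] := order_stat_attained (k := M.-1) g t ltac:(by rewrite ltn_predL).
  have bnd := order_stat_bounds g t.
  rewrite /E /eps2 /= tdma_lt_noma_rate1 ?tdma_lt_noma_rate2 ?gi ?gj ?mulr_gt0//.
  rewrite ![rho * _]mulrC -[w2 a < _]ltr_pdivrMr// -[_ < w2 a]ltr_pdivlMr// -/c.
  split.
    move=> [ci cj] [/(_ i I)|/(_ j I)] /=; rewrite in_itv/= ?andbT.
      by rewrite leNgt ci.
    by rewrite leNgt cj.
  move=> nAB; split; rewrite ltNge; apply/negP => h; apply: nAB; [left|right].
    move=> k _ /=; rewrite in_itv/= andbT (le_trans h)// -gi.
    by case/andP: (bnd k).
  move=> k _ /=; rewrite in_itv/= (le_trans _ h)// -gj.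
  by case/andP: (bnd k).
have mAB : measurable (~` (A `|` B)).
  by apply: measurableC; exact: measurableU.
rewrite -(measureU0 mE (measurableC mZ) PZC) EAB.
rewrite (measureU0 mAB (measurableC mZ) PZC).
rewrite [LHS](probability_setC P (measurableU _ _ mA mB)).
have -> : P (A `|` B) = (P A + P B - P (A `&` B))%E.
  by apply: measureUfinl => //; exact: (le_lt_trans (probability_le1 P mA) (ltry 1)).
rewrite PA PB PAB sube0 -EFinD; congr EFin.
by rewrite opprD addrA addrAC.
Qed.

(** * The optimal power coefficient *)

(** Taking logarithms gives [w2 a = K], that is [K * a^2 + 2 * a = 1]; multiplying by [K] and
    completing the square yields [(K * a + 1)^2 = 1 + K]. Positivity of [a] selects the root. *)
Lemma expR_w2_eq_half {R : realType} (rho a : R) : 0 < rho -> 0 < a ->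
  expR (- w2 a / rho) = 2^-1 <->
  a = (- 1 + Num.sqrt (1 + rho * ln 2)) / (rho * ln 2).
Proof.
move=> rho0 a0; set K := rho * ln 2.
have K0 : 0 < K by rewrite mulr_gt0// ln_gt0// ltr1n.
have K10 : 0 <= 1 + K by rewrite ltW// addr_gt0.
have halfE : expR (- w2 a / rho) = 2^-1 <-> (K * a + 1) ^+ 2 = 1 + K.
  have -> : 2^-1 = expR (- ln 2) :> R by rewrite expRN lnK// posrE.
  have key : (K * a + 1) ^+ 2 - (1 + K) =
      K * a ^+ 2 * rho * (ln 2 - w2 a / rho).
    by rewrite /w2 /K; field; rewrite !gt_eqF.
  split => [/expR_inj|/eqP].
    rewrite mulNr => /oppr_inj h; apply/eqP.
    by rewrite -subr_eq0 key h subrr mulr0.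
  rewrite -subr_eq0 key mulf_eq0 gt_eqF/=; last first.
    by rewrite mulr_gt0// mulr_gt0// exprn_gt0.
  by rewrite subr_eq0 mulNr => /eqP ->.
apply: (iff_trans halfE); split => [h|->].
  rewrite -h sqrtr_sqr ger0_norm; last by rewrite addr_ge0// mulr_ge0 ?ltW.
  by field; rewrite gt_eqF.
rewrite -[RHS]sqr_sqrtr//; congr (_ ^+ 2).
by field; rewrite gt_eqF.
Qed.

(** With [s = sqrt (1 + K)] one has [K = (s - 1) * (s + 1)], so the quotient is [1 / (s + 1)] with
    [s > 1]. *)
Lemma sqrt_ratio_bounds {R : rcfType} (K : R) : 0 < K ->
  0 < (- 1 + Num.sqrt (1 + K)) / K < 2^-1.
Proof.
move=> K0; have : Num.sqrt (1 + K) ^+ 2 = 1 + K by rewrite sqr_sqrtr// ltW// addr_gt0.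
have : 0 <= Num.sqrt (1 + K) by rewrite sqrtr_ge0.
set s := Num.sqrt _ => s0 sE.
have s1 : 1 < s by rewrite ltNge; apply/negP => h; nra.
apply/andP; split; first by rewrite divr_gt0//; lra.
rewrite ltr_pdivrMr//; nra.
Qed.

Theorem mainTheorem2 (R : realType) (disp : measure_display)
    (T : measurableType disp) (P : probability T R)
    (M : nat) (M_ge2 : (2 <= M)%N) (rho : R) (rho_gt0 : 0 < rho)
    (g : 'I_M -> {RV P >-> R})
    (g_indep : mutually_independent g)
    (g_exp : forall i, has_exponential_law 1 (g i)) :
  let x : T -> R := fun t => rho * order_stat g 0 t in
  let y : T -> R := fun t => rho * order_stat g M.-1 t in
  let Peps2 : R -> \bar R := fun a2 => P (eps2 (1 - a2) a2 x y) in
  let d : R -> R := fun a2 => expR (- w2 a2 / rho) in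
  let a2opt : R := (- 1 + Num.sqrt (1 + rho * ln 2)) / (rho * ln 2) in
  [/\ forall a2 : R, 0 < a2 <= 2^-1 ->
        Peps2 a2 = (1 - (1 - d a2) ^+ M - d a2 ^+ M)%:E,
      forall a2 : R, 0 < a2 <= 2^-1 ->
        ((forall b2 : R, 0 < b2 <= 2^-1 -> (Peps2 b2 <= Peps2 a2)%E) <->
         d a2 = 2^-1),
      forall a2 : R, 0 < a2 <= 2^-1 -> (d a2 = 2^-1 <-> a2 = a2opt),
      0 < a2opt < 2^-1 &
      Peps2 a2opt = (1 - 1 / 2 ^+ (M - 1))%:E].
Proof.
move=> x y Peps2 d a2opt.
have M0 : (0 < M)%N by exact: ltnW.
have K0 : 0 < rho * ln 2 by rewrite mulr_gt0// ln_gt0// ltr1n.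
have Pd a : 0 < a <= 2^-1 -> Peps2 a = (1 - (1 - d a) ^+ M - d a ^+ M)%:E.
  by move=> ha; exact: prob_eps2_minmax.
have optP : 0 < a2opt < 2^-1 by exact: sqrt_ratio_bounds.
have opt_le : 0 < a2opt <= 2^-1 by case/andP: optP => -> /ltW ->.
have dP a : 0 < a <= 2^-1 -> (d a = 2^-1 <-> a = a2opt).
  by move=> /andP[a0 _]; exact: expR_w2_eq_half.
have dopt : d a2opt = 2^-1 by apply/dP.
have half : 1 - 2^-1 = 2^-1 :> R by lra.
have Popt : Peps2 a2opt = (1 - 2 * 2^-1 ^+ M)%:E.
  by rewrite Pd// dopt half; congr EFin; lra.
have d01 a : 0 < a <= 2^-1 -> 0 <= d a <= 1.
  move=> /andP[a0 a1]; rewrite expR_ge0 -expR0 ler_expR mulNr oppr_le0.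
  by rewrite divr_ge0 ?(ltW rho_gt0)// divr_ge0 ?exprn_ge0 ?(ltW a0)//; lra.
(* Strictness serves both directions of the characterization: a maximizer cannot have [d a != 1/2],
   and every such value stays below the one at [a2opt]. *)
have Plt a : 0 < a <= 2^-1 -> d a != 2^-1 -> (Peps2 a < Peps2 a2opt)%E.
  move=> ha da; rewrite Popt Pd// lte_fin.
  by have := lt_sum_expr_half M_ge2 (d01 a ha) da; lra.
split => //.
- move=> a ha; split => [amax|da b hb].
    apply/eqP; apply: contraT => /(Plt a ha).
    by rewrite ltNge amax.
  have -> : Peps2 a = Peps2 a2opt by move/(dP a ha): da => ->.
  by have [/(dP b hb)->//|/eqP/(Plt b hb)/ltW] := pselect (d b = 2^-1).
(* The truncated [M - 1] is resolved by writing [M] as a successor; one factor 1/2 then cancels the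
   2. *)
- rewrite Popt; congr EFin; case: (M) M0 => // n _.
  by rewrite subSS subn0 exprS mulrA divff ?mul1r ?div1r ?exprVn// pnatr_eq0.
Qed.
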